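(* Let $K_1\subset\mathbb{R}^k$ and $K_2,K_3\subset\mathbb{R}^d$ be compact. Let $\nu$ be a Borel probability measure on $K_1\times K_2$ whose first marginal $m$ is centered, $\int_{K_1}\tilde x\,m(d\tilde x)=0$, and let $\mu$ be a Borel probability measure on $K_3$. Let $I(\mu,\nu)$ be the set of Borel probability measures $\theta$ on $K_1\times K_2\times K_3$ whose marginal on the $(\tilde x,y)$-coordinates is $\nu$ and whose marginal on the $(\tilde x,u)$-coordinates is $m\otimes\mu$. Then $$\max_{\theta\in I(\mu,\nu)}\int u^\top y\,\theta(d\tilde x,dy,du)=\inf\Big\{\int_{K_1\times K_2}\psi\,d\nu+\int_{K_1\times K_3}\varphi\,d(m\otimes\mu)\Big\},$$ where the infimum is over $(\psi,\varphi)\in C(K_1\times K_2)\times C(K_1\times K_3)$ satisfying $\psi(\tilde x,y)+\varphi(\tilde x,u)\ge u^\top y$ for all $(\tilde x,y,u)\in K_1\times K_2\times K_3$ (and the maximum is attained). This common value also equals the infimum of the same objective taken over $(\psi,\varphi)\in L^1(\nu)\times L^1(m\otimes\mu)$ satisfying the same constraint. *)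

(* Defs.v *)
From HB Require Import structures.
From mathcomp Require Import all_boot all_order all_algebra.
From mathcomp Require Import all_classical all_reals all_analysis.
Set Implicit Arguments. Unset Strict Implicit. Unset Printing Implicit Defensive.
Import Order.TTheory GRing.Theory Num.Theory.
Import numFieldNormedType.Exports.
Local Open Scope classical_set_scope.
Local Open Scope ring_scope.

Section borel_rV.
Variables (R : realType) (n : nat).

Definition borel_rV : set (set 'rV[R]_n) := <<s @open 'rV[R]_n >>.

Lemma borel_rV0 : borel_rV set0.
Proof. exact: (@sigma_algebra0 _ setT). Qed.

Lemma borel_rVC (A : set 'rV[R]_n) : borel_rV A -> borel_rV (~` A).
Proof. by move=> sGA; rewrite -setTD; exact: sigma_algebraCD. Qed.

Lemma borel_rVU (F : (set 'rV[R]_n)^nat) :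
  (forall i, borel_rV (F i)) -> borel_rV (\bigcup_i F i).
Proof. exact: (@sigma_algebra_bigcup _ setT). Qed.

HB.instance Definition _ := @isMeasurable.Build default_measure_display
  'rV[R]_n borel_rV borel_rV0 borel_rVC borel_rVU.
End borel_rV.

Definition dotv (R : realType) (d : nat) (u y : 'rV[R]_d) : R :=
  \sum_(i < d) u 0 i * y 0 i.

(* Transport maps for the marginals of theta on K1 x K2 x K3:
   a point of ('rV_k * 'rV_d) * 'rV_d is ((x, y), u). *)
Definition proj_xy (R : realType) (k d : nat)
  (p : ('rV[R]_k * 'rV[R]_d) * 'rV[R]_d) : 'rV[R]_k * 'rV[R]_d := p.1.
Definition proj_xu (R : realType) (k d : nat)
  (p : ('rV[R]_k * 'rV[R]_d) * 'rV[R]_d) : 'rV[R]_k * 'rV[R]_d := (p.1.1, p.2).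

(* Main.v *)
Require Import Defs.
From HB Require Import structures.
From mathcomp Require Import all_boot all_order all_algebra.
From mathcomp Require Import all_classical all_reals all_analysis.
From mathcomp Require Import measurable_realfun lra.
Set Implicit Arguments. Unset Strict Implicit. Unset Printing Implicit Defensive.
Import Order.TTheory GRing.Theory Num.Theory.
Import numFieldNormedType.Exports.
Local Open Scope classical_set_scope.
Local Open Scope ring_scope.

(** Weak duality gives sup <= inf over L^1 <= inf over continuous pairs, so it
    suffices to find a coupling whose cost reaches the continuous infimum.
    Write K for K1 x K2 x K3 and let pi be a continuous surjection of the Cantor
    space onto K.  For a bounded function f on the Cantor space let p f be the
    infimum of the dual objective over the continuous pairs (psi, phi) such that
    psi + phi, pulled back along pi, dominates f.  Weak duality against nu \x mu
    makes p finite, and p is sublinear, so Hahn-Banach provides a linear L <= p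
    which agrees with p at the pulled-back cost.  The bound L <= p forces L to be
    positive and to have the prescribed marginals on continuous functions.  The
    content A |-> L 1_A on clopen sets is countably additive because clopen sets
    are compact, hence it extends to a measure, which represents L on continuous
    functions; its image under pi is the optimal coupling. *)

(** * Hahn-Banach *)

Section hahn_banach.
Context {R : realType} {V : lmodType R} (S : set V).
Hypothesis SD : forall x y, S x -> S y -> S (x + y).
Hypothesis SZ : forall (t : R) x, S x -> S (t *: x).
Hypothesis S0 : S 0.

Definition sublinear_on (q : V -> R) :=
  (forall x y, S x -> S y -> q (x + y) <= q x + q y) /\
  (forall (t : R) x, 0 < t -> S x -> q (t *: x) <= t * q x).

Let SN x : S x -> S (- x).
Proof. by move=> Sx; rewrite -scaleN1r; exact: SZ. Qed.

Lemma sublinear_on0 q : sublinear_on q -> q 0 = 0.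
Proof.
move=> [_ qZ]; have h1 := @qZ 2 0 ltac:(by []) S0.
have h2 := @qZ (2^-1) 0 ltac:(by []) S0.
rewrite scaler0 in h1; rewrite scaler0 in h2; lra.
Qed.

Lemma sublinear_onZ q (t : R) x : sublinear_on q -> 0 <= t -> S x ->
  q (t *: x) = t * q x.
Proof.
move=> sq; rewrite le_eqVlt => /predU1P[<- _|t0 Sx].
  by rewrite scale0r mul0r sublinear_on0.
apply/eqP; rewrite eq_le; apply/andP; split; first exact: sq.2.
have ti : 0 < t^-1 by rewrite invr_gt0.
have /(ler_wpM2l (ltW t0)) := sq.2 _ _ ti (SZ t Sx).
by rewrite mulrA mulfV ?gt_eqF// mul1r scalerA mulVf ?gt_eqF// scale1r.
Qed.

Lemma sublinear_onN q x : sublinear_on q -> S x -> - q (- x) <= q x.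
Proof.
move=> sq Sx; have := sq.1 _ _ Sx (SN Sx).
by rewrite subrr sublinear_on0// => h; rewrite -subr_ge0 opprK.
Qed.

Lemma sublinear_on_le_opp p q x : sublinear_on q ->
  (forall x, S x -> q x <= p x) -> S x -> - p (- x) <= q x.
Proof.
move=> sq qp Sx; apply: le_trans (sublinear_onN sq Sx).
by rewrite lerN2; apply: qp; exact: SN.
Qed.

(* The largest sublinear [r <= q] with [r (- v) = - q v]. *)
Definition tilt (q : V -> R) v x :=
  inf [set q (x + t *: v) - t * q v | t in [set t : R | 0 <= t]].

Lemma tilt_lb q v x (t : R) : sublinear_on q -> S v -> S x -> 0 <= t ->
  - q (- x) <= q (x + t *: v) - t * q v.
Proof.
move=> sq Sv Sx t0; rewrite -sublinear_onZ//.
have := sq.1 _ _ (SN Sx) (SD Sx (SZ t Sv)).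
by rewrite addrA addNr add0r => h; lra.
Qed.

Lemma tilt_le q v x (t : R) : sublinear_on q -> S v -> S x -> 0 <= t ->
  tilt q v x <= q (x + t *: v) - t * q v.
Proof.
move=> sq Sv Sx t0; apply: ge_inf; last by exists t.
by exists (- q (- x)) => _ [s s0 <-]; exact: tilt_lb.
Qed.

Lemma le_tilt q v x (a : R) :
  (forall t : R, 0 <= t -> a <= q (x + t *: v) - t * q v) -> a <= tilt q v x.
Proof.
move=> h; apply: lb_le_inf; last by move=> _ [t t0 <-]; exact: h.
by exists (q (x + 0 *: v) - 0 * q v), 0 => /=.
Qed.

Lemma tilt_sublinear q v : sublinear_on q -> S v -> sublinear_on (tilt q v).
Proof.
move=> sq Sv; split.
  move=> x y Sx Sy; rewrite -lerBlDr; apply: le_tilt => s s0.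
  rewrite lerBlDl -lerBlDr; apply: le_tilt => t t0.
  rewrite lerBlDr.
  apply: le_trans (tilt_le sq Sv (SD Sx Sy) (addr_ge0 s0 t0)) _.
  have := sq.1 _ _ (SD Sx (SZ s Sv)) (SD Sy (SZ t Sv)).
  by rewrite addrACA -scalerDl => h; lra.
move=> t x t0 Sx; rewrite -ler_pdivrMl//; apply: le_tilt => s s0.
rewrite ler_pdivrMl//.
apply: le_trans (tilt_le sq Sv (SZ t Sx) (mulr_ge0 (ltW t0) s0)) _.
by rewrite -scalerA -scalerDr mulrBr mulrA lerB// (sublinear_onZ sq (ltW t0) (SD Sx (SZ _ Sv))).
Qed.

Lemma tilt_le_self q v x : sublinear_on q -> S v -> S x -> tilt q v x <= q x.
Proof.
move=> sq Sv Sx; have := tilt_le sq Sv Sx (lexx 0).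
by rewrite scale0r addr0 mul0r subr0.
Qed.

Lemma minimal_sublinear p : sublinear_on p ->
  exists q, [/\ sublinear_on q, forall x, S x -> q x <= p x &
    forall r, sublinear_on r -> (forall x, S x -> r x <= q x) ->
      forall x, S x -> q x <= r x].
Proof.
move=> sp; pose P q := sublinear_on q /\ forall x, S x -> q x <= p x.
pose le (q r : {q | P q}) := `[< forall x, S x -> sval r x <= sval q x >].
have Pp : P p by split.
have [||A totA|q maxq] := @ZL_preorder _ (exist _ p Pp) le.
- by move=> q; apply/asboolP.
- move=> q r s /asboolP qr /asboolP rs; apply/asboolP => x Sx.
  exact: le_trans (rs _ Sx) (qr _ Sx).
- have [[q0 Aq0]|A0] := pselect (exists q, A q); last first.
    by exists (exist _ p Pp) => s As; case: A0; exists s.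
  pose r x := inf [set sval q x | q in A].
  have lbr x : S x -> has_lbound [set sval q x | q in A].
    move=> Sx; exists (- p (- x)) => _ [[q [sq qp]] Aq <-] /=.
    exact: sublinear_on_le_opp.
  have rle x q : S x -> A q -> r x <= sval q x.
    by move=> Sx Aq; apply: ge_inf; [exact: lbr|exists q].
  have le_inf_r x a : (forall q, A q -> a <= sval q x) -> a <= r x.
    move=> h; apply: lb_le_inf; first by exists (sval q0 x), q0.
    by move=> _ [q Aq <-]; exact: h.
  have Pr : P r.
    split; last first.
      by move=> x Sx; apply: le_trans (rle x q0 Sx Aq0) _; exact: (svalP q0).2.
    split.
      move=> x y Sx Sy; rewrite -lerBlDr; apply: (le_inf_r) => s As.
      rewrite lerBlDl -lerBlDr; apply: (le_inf_r) => t At; rewrite lerBlDr.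
      have [|] := totA _ _ As At; rewrite /le => /asboolP st.
        apply: le_trans (rle _ _ (SD Sx Sy) At) _.
        apply: le_trans ((proj1 (svalP t)).1 _ _ Sx Sy) _.
        by rewrite addrC lerD2l; exact: st.
      apply: le_trans (rle _ _ (SD Sx Sy) As) _.
      apply: le_trans ((proj1 (svalP s)).1 _ _ Sx Sy) _.
      by rewrite addrC lerD2r; exact: st.
    move=> t x t0 Sx; rewrite -ler_pdivrMl//; apply: (le_inf_r) => q Aq.
    rewrite ler_pdivrMl//; apply: le_trans (rle _ _ (SZ t Sx) Aq) _.
    exact: (proj1 (svalP q)).2.
  by exists (exist _ r Pr) => s As; apply/asboolP => x Sx; exact: rle.
exists (sval q); split; [exact: (svalP q).1|exact: (svalP q).2|].
move=> r sr rq.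
have Pr : P r.
  by split => // x Sx; apply: le_trans (rq _ Sx) _; exact: (svalP q).2.
have := maxq (exist _ r Pr); rewrite /le/= => h.
by apply/asboolP; apply: h; exact/asboolP.
Qed.

(* A minimal sublinear functional equals all its tilts, hence is additive. *)
Theorem hahn_banach_on p v : sublinear_on p -> S v ->
  exists f : V -> R, [/\
    forall x y, S x -> S y -> f (x + y) = f x + f y,
    forall (t : R) x, S x -> f (t *: x) = t * f x,
    forall x, S x -> f x <= p x & f v = p v].
Proof.
move=> sp Sv.
have [q [sq qp minq]] := minimal_sublinear (tilt_sublinear sp Sv).
have qD x y : S x -> S y -> q (x + y) = q x + q y.
  move=> Sx Sy; apply/eqP; rewrite eq_le; apply/andP; split; first exact: sq.1.
  have := minq _ (tilt_sublinear sq Sy) (fun z Sz => tilt_le_self sq Sy Sz) _ Sx.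
  move=> /le_trans/(_ (tilt_le sq Sy Sx ler01)).
  by rewrite scale1r mul1r lerBrDr.
have qN x : S x -> q (- x) = - q x.
  move=> Sx; apply/eqP; rewrite -addr_eq0 -qD ?addNr ?sublinear_on0//.
  exact: SN.
have qlep x : S x -> q x <= p x.
  by move=> Sx; apply: le_trans (qp _ Sx) _; exact: tilt_le_self.
exists q; split => //.
  move=> t x Sx; have [t0|/ltW t0] := leP 0 t; first exact: sublinear_onZ.
  rewrite -[in LHS](opprK t) scaleNr qN; last exact: SZ.
  by rewrite (sublinear_onZ sq)// ?oppr_ge0// mulNr opprK.
apply/eqP; rewrite eq_le qlep//= -lerN2 -qN//.
apply: le_trans (qp _ (SN Sv)) _.
apply: le_trans (tilt_le sp Sv (SN Sv) ler01) _.
by rewrite scale1r mul1r addNr (sublinear_on0 sp) sub0r.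
Qed.

End hahn_banach.

(** * Riesz representation on the Cantor space *)

Lemma compact_cantor_surj (R : realType) (X : pseudoMetricType R) (K : set X) :
  hausdorff_space X -> compact K -> K !=set0 ->
  exists2 f : cantor_space -> X, continuous f & range f = K.
Proof.
move=> hX cK [k0 Kk0].
pose pt : set_type K := exist _ k0 (mem_set Kk0).
pose T : pseudoPMetricType R :=
  HB.pack_for (pseudoPMetricType R) (set_type K) (isPointed.Build (set_type K) pt).
have cval : continuous (set_val : T -> X) by exact: initial_continuous.
have cT : compact [set: T].
  apply/compact_near_coveringP => I F P FF Pnear.
  have /compact_near_coveringP := cK.
  move=> /(_ I F (fun i x => forall y : T, set_val y = x -> P i y) FF) KF.
  have {}KF : F [set i | K `<=` fun x => forall y : T, set_val y = x -> P i y].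
    apply: KF => x Kx.
    have [[U i] /= [Ux Fi] UiP] := Pnear (exist _ x (mem_set Kx) : T) Logic.I.
    case: Ux => _ [[W oW <-] /= Wx WU].
    exists (W, i) => /=; first by split => //; exact: open_nbhs_nbhs.
    move=> [x' i'] /= [Wx' ii'] y yx; apply: (UiP (y, i')); split => //=.
    by apply: WU; rewrite /preimage/= yx.
  apply: filterS (KF) => i Ki y _.
  by apply: (Ki (set_val y)) => //; exact: set_valP.
have hT : hausdorff_space T.
  move=> x y xy; apply: val_inj; apply: hX => A B nA nB.
  have [z [Az Bz]] := xy _ _ (cval x _ nA) (cval y _ nB).
  by exists (set_val z).
have [f cf] := cantor_surj cT hT.
exists (set_val \o f).
  by move=> x; apply: continuous_comp; [exact: cf|exact: cval].
apply/seteqP; split=> [_ [x _ <-]|x Kx]; first exact: set_valP.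
have [z _ fz] := 'surj_f (I : [set: T] (exist _ x (mem_set Kx))).
by exists z => //=; rewrite fz.
Qed.

Section mean.
Context {R : realType} {T : Type}.

Definition bounded_fn (f : T -> R) := exists M : R, forall x, `|f x| <= M.

Record positive_mean (L : (T -> R) -> R) : Prop := PositiveMean {
  pmeanD : forall f g, bounded_fn f -> bounded_fn g ->
    L (fun x => f x + g x) = L f + L g ;
  pmeanZ : forall t f, bounded_fn f -> L (fun x => t * f x) = t * L f ;
  pmean_ge0 : forall f, bounded_fn f -> (forall x, 0 <= f x) -> 0 <= L f ;
  pmean1 : L (cst 1) = 1 }.

Lemma bounded_fnD f g : bounded_fn f -> bounded_fn g ->
  bounded_fn (fun x => f x + g x).
Proof.
move=> [M Mf] [N Ng]; exists (M + N) => x.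
by apply: le_trans (ler_normD _ _) _; exact: lerD.
Qed.

Lemma bounded_fnZ t f : bounded_fn f -> bounded_fn (fun x => t * f x).
Proof.
by move=> [M Mf]; exists (`|t| * M) => x; rewrite normrM ler_wpM2l.
Qed.

Lemma bounded_cst c : bounded_fn (cst c).
Proof. by exists `|c| => x. Qed.

Lemma bounded_indic (A : set T) : bounded_fn \1_A.
Proof. by exists 1 => x; rewrite indicE; case: (_ \in _); rewrite ?normr1 ?normr0. Qed.

Variables (L : (T -> R) -> R) (LP : positive_mean L).

Lemma pmean_cst c : L (cst c) = c.
Proof.
have <- : (fun x => c * cst 1 x) = cst c :> (T -> R).
  by apply/funext => x; rewrite /= mulr1.
by rewrite (pmeanZ LP _ (bounded_cst 1)) (pmean1 LP) mulr1.
Qed.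

Lemma pmean_le f g : bounded_fn f -> bounded_fn g -> (forall x, f x <= g x) ->
  L f <= L g.
Proof.
move=> bf bg fg; pose h := fun x => g x + (-1) * f x.
have bNf := bounded_fnZ (-1) bf.
have : 0 <= L h.
  apply: (pmean_ge0 LP); first exact: bounded_fnD.
  by move=> x; rewrite /h mulN1r subr_ge0.
by rewrite (pmeanD LP bg bNf) (pmeanZ LP _ bf) mulN1r subr_ge0.
Qed.

Lemma pmean_dist f g (e : R) : bounded_fn f -> bounded_fn g ->
  (forall x, `|f x - g x| <= e) -> `|L f - L g| <= e.
Proof.
have half f' g' : bounded_fn f' -> bounded_fn g' ->
    (forall x, `|f' x - g' x| <= e) -> L f' - L g' <= e.
  move=> bf bg fg; rewrite lerBlDl -[X in _ + X]pmean_cst.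
  rewrite -(pmeanD LP)//; last exact: bounded_cst.
  apply: pmean_le => //; first by apply: bounded_fnD => //; exact: bounded_cst.
  by move=> x /=; rewrite -lerBlDl; exact: le_trans (ler_norm _) (fg x).
move=> bf bg fg; rewrite ler_norml lerNl opprB half//=; last first.
  by move=> x; rewrite distrC.
exact: half.
Qed.

End mean.

Lemma continuous_bounded_fn (R : realType) (T : topologicalType) (f : T -> R) :
  compact [set: T] -> continuous f -> bounded_fn f.
Proof.
move=> cT cf.
have /compact_bounded[M [_ /(_ (M + 1))]] : compact (f @` setT).
  by apply: continuous_compact => //; exact: continuous_subspaceT.
rewrite ltrDl ltr01 => /(_ isT) h.
by exists (M + 1) => x; apply: h; exists x.
Qed.

Definition clopen_algebra := cantor_space.
HB.instance Definition _ := Pointed.on clopen_algebra.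

Lemma clopen_setC : setC_closed (@clopen cantor_space).
Proof. by move=> A [oA cA]; split; [exact: closed_openC|exact: open_closedC]. Qed.

HB.instance Definition _ := @isAlgebraOfSets.Build default_measure_display
  clopen_algebra (@clopen cantor_space) (@clopen0 _) (@clopenU _) clopen_setC.

Section clopen_content.
Context {R : realType} (L : (cantor_space -> R) -> R).

Definition clopen_content of positive_mean L :=
  fun A : set clopen_algebra => (L \1_A)%:E.

Variable LP : positive_mean L.
Local Notation mu := (clopen_content LP).
Local Open Scope ereal_scope.

Let mu0 : mu set0 = 0.
Proof.
by rewrite /clopen_content indic0 (pmean_cst LP).
Qed.

Let mu_ge0 A : 0 <= mu A.
Proof.
by rewrite lee_fin; apply: (pmean_ge0 LP); [exact: bounded_indic|].
Qed.

Let mu_additive : measure_function.semi_additive mu.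
Proof.
apply/(additive2P mu0) => A B mA mB AB0; rewrite -EFinD -(pmeanD LP).
- congr (L _)%:E; apply/funext => x; rewrite !indicE in_setU.
  have [xA|] := boolP (x \in A); have [xB|] := boolP (x \in B) => //=;
    rewrite ?addr0 ?add0r//.
  by move: AB0 => /seteqP[/(_ x)/= +_] => /(_ (conj (set_mem xA) (set_mem xB))).
- exact: bounded_indic.
- exact: bounded_indic.
Qed.

HB.instance Definition _ := isContent.Build _ _ _ mu mu_ge0 mu_additive.

(* Countable covers of a clopen set by clopen sets have finite subcovers. *)
Let mu_subadditive : measurable_subset_sigma_subadditive mu.
Proof.
move=> A F mF mA AF.
have /compact_near_coveringP cA : compact (A : set cantor_space).
  by apply: subclosed_compact cantor_space_compact _ => //; case: mA.
have [N _ /(_ N (leqnn _)) AN] : \forall n \near \oo,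
    A `<=` \bigcup_(i in `I_n) F i.
  apply: (cA nat \oo (fun n => \bigcup_(i in `I_n) F i)) => x Ax.
  have [i _ Fix] := AF x Ax.
  exists (F i, [set n | (i < n)%N]) => /=.
    split; last by exists i.+1.
    by apply: open_nbhs_nbhs; split => //; case: (mF i).
  by move=> [y n] /= [Fy ni]; exists i.
apply: le_trans (nneseries_lim_ge N _); last by move=> *; exact: mu_ge0.
apply: (@le_trans _ _ (L (fun x => \sum_(0 <= i < N) \1_(F i) x)%R)%:E).
  rewrite lee_fin; apply: (pmean_le LP); first exact: bounded_indic.
    elim: (N) => [|n ih]; first by exists 0%R => x; rewrite big_geq// normr0.
    under eq_fun do rewrite big_nat_recr//=.
    by apply: bounded_fnD => //; exact: bounded_indic.
  move=> x; rewrite indicE; have [xA|_] := boolP (x \in A); last first.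
    by apply: sumr_ge0 => i _; rewrite indicE.
  have [i /= iN Fix] := AN x (set_mem xA).
  rewrite (@bigD1_seq _ _ _ _ _ i) ?mem_index_iota ?iota_uniq//=.
  by rewrite indicE mem_set// lerDl; apply: sumr_ge0 => j _; rewrite indicE.
pose s n (x : cantor_space) : R := (\sum_(0 <= i < n) \1_(F i) x)%R.
have s0 : s 0%N = cst 0%R by apply/funext => x; rewrite /s big_geq.
have sS n : s n.+1 = fun x => (s n x + \1_(F n) x)%R.
  by apply/funext => x; rewrite /s big_nat_recr.
have Lsum n : bounded_fn (s n) /\ (L (s n))%:E = \sum_(0 <= i < n) mu (F i).
  elim: n => [|n [bn ih]].
    by rewrite s0 big_geq// (pmean_cst LP); split => //; exact: bounded_cst.
  rewrite sS; split; first by apply: bounded_fnD => //; exact: bounded_indic.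
  rewrite (pmeanD LP)//; last exact: bounded_indic.
  by rewrite big_nat_recr//= -ih EFinD.
by rewrite -(Lsum N).2.
Qed.

HB.instance Definition _ :=
  Content_SigmaSubAdditive_isMeasure.Build _ _ _ mu mu_subadditive.

End clopen_content.

Section clopen_step.
Context {R : realType}.

Inductive clopen_step : (cantor_space -> R) -> Prop :=
| clopen_step0 : clopen_step (cst 0)
| clopen_stepD c A s : clopen A -> clopen_step s ->
    clopen_step (fun x => s x + c * \1_A x).

Lemma clopen_step_bounded s : clopen_step s -> bounded_fn s.
Proof.
elim=> [|c A {}s _ _ ih]; first exact: bounded_cst.
by apply: bounded_fnD => //; apply: bounded_fnZ; exact: bounded_indic.
Qed.

Lemma clopen_step_approx (g : cantor_space -> R) (e : R) :
  continuous g -> 0 < e ->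
  exists2 s, clopen_step s & forall x, `|g x - s x| <= e.
Proof.
move=> cg e0.
have /choice[D DP] : forall x, exists D : set cantor_space,
    [/\ clopen D, D x & forall y, D y -> `|g y - g x| <= e].
  move=> x; have := @zero_dimensional_cvg _ x cantor_space_hausdorff
    cantor_zero_dimensional cantor_space_compact.
  have /cvgrPdist_le/(_ e e0) gx := cg x.
  move=> /(_ _ gx)[D [Dx cD] Dg]; exists D; split => // y Dy.
  by rewrite distrC; exact: Dg.
have := cantor_space_compact; rewrite compact_cover.
move=> /(_ _ setT D)[x _|x _|F _ TF]; first by have [[]] := DP x.
  by exists x => //; have [] := DP x.
have H (l : seq cantor_space) : exists s U, [/\ clopen_step s, clopen U,
    (forall x, x \in l -> D x `<=` U), (forall x, U x -> `|g x - s x| <= e) &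
    forall x, ~ U x -> s x = 0].
  elim: l => [|x l [s [U [cs cU lU gs s0]]]].
    exists (cst 0), set0; split => //; [exact: clopen_step0|exact: clopen0].
  have [cD Dx Dg] := DP x.
  have cDU : clopen (D x `&` ~` U) by apply: clopenI => //; exact: clopen_setC.
  exists (fun y => s y + g x * \1_(D x `&` ~` U) y), (U `|` D x); split.
  - exact: clopen_stepD.
  - exact: clopenU.
  - move=> y; rewrite inE => /predU1P[->|yl]; first by move=> z; right.
    by move=> z Dz; left; exact: lU Dz.
  - move=> y Uy; have [yU|yU] := pselect (U y).
      rewrite indicE memNset; first by rewrite mulr0 addr0; exact: gs.
      by case.
    have Dy : D x y by case: Uy.
    by rewrite indicE mem_set// mulr1 s0// add0r; exact: Dg.
  - move=> y /not_orP[yU yD]; rewrite s0// indicE memNset ?mulr0 ?addr0//.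
    by case.
have [s [U [cs cU lU gs s0]]] := H (finmap.enum_fset F).
by exists s => // x; apply: gs; have [y yF Dy] := TF x Logic.I; exact: lU Dy.
Qed.

End clopen_step.

Notation cantor_borel :=
  (g_sigma_algebraType (@measurable default_measure_display clopen_algebra)).

Lemma cantor_borel_clopen (A : set cantor_space) : clopen A ->
  measurable (A : set cantor_borel).
Proof. exact: sub_sigma_algebra. Qed.

Lemma clopen_step_measurable (R : realType) (s : cantor_space -> R) :
  clopen_step s -> measurable_fun [set: cantor_borel] (s : cantor_borel -> R).
Proof.
elim=> [|c A {}s cA _ ih]; first exact: measurable_cst.
apply: measurable_funD => //; apply: measurable_funM; first exact: measurable_cst.
by apply: measurable_indic; exact: cantor_borel_clopen.
Qed.

Lemma continuous_cantor_measurable (R : realType) (g : cantor_space -> R) :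
  continuous g -> measurable_fun [set: cantor_borel] (g : cantor_borel -> R).
Proof.
move=> cg.
have /choice[s sP] : forall n : nat, exists s, clopen_step s /\
    forall x, `|g x - s x| <= n.+1%:R^-1.
  by move=> n; have [|s] := @clopen_step_approx R g n.+1%:R^-1 cg; [|exists s].
apply: (@measurable_fun_cvg _ cantor_borel R setT s g).
  by move=> n; apply: clopen_step_measurable; exact: (sP n).1.
move=> x _; apply/cvgrPdist_le => e e0.
near=> n; apply: le_trans ((sP n).2 x) _; near: n.
by have := near_infty_natSinv_lt (PosNum e0); apply: filterS => n /ltW.
Unshelve. all: by end_near. Qed.

Section bounded_integral.
Context d (T : measurableType d) (R : realType) (P : probability T R).

Lemma bounded_integrable_prob (f : T -> R) : measurable_fun setT f -> bounded_fn f ->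
  P.-integrable setT (EFin \o f).
Proof.
move=> mf [M Mf]; apply: measurable_bounded_integrable => //.
  by rewrite -ge0_fin_numE// fin_num_measure.
by exists M; split; [exact: num_real|move=> x Mx y _; exact: le_trans (Mf y) (ltW Mx)].
Qed.

Lemma Rintegral_dist (f g : T -> R) (e : R) : measurable_fun setT f -> bounded_fn f ->
  measurable_fun setT g -> bounded_fn g ->
  (forall x, `|f x - g x| <= e) -> `|\int[P]_x f x - \int[P]_x g x| <= e.
Proof.
move=> mf bf mg bg fg; rewrite -RintegralB//; try exact: bounded_integrable_prob.
have bfg : bounded_fn (fun x => f x - g x) by exists e.
have ifg : P.-integrable setT (EFin \o (fun x => f x - g x)).
  by apply: bounded_integrable_prob => //; exact: measurable_funB.
apply: le_trans (le_normr_Rintegral measurableT ifg) _.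
have -> : e = \int[P]_(x in setT) (cst e x).
  rewrite Rintegral_cst// [X in fine X](_ : _ = 1%E) ?mulr1//.
  exact: probability_setT.
apply: le_Rintegral => //; last by apply: bounded_integrable_prob => //; exact: bounded_cst.
apply: bounded_integrable_prob; last by exists e => x; rewrite normr_id.
by apply: measurableT_comp => //; exact: measurable_funB.
Qed.

End bounded_integral.

Section riesz.
Context {R : realType} (L : (cantor_space -> R) -> R) (LP : positive_mean L).

Definition riesz_measure : set cantor_borel -> \bar R :=
  measure_extension (clopen_content LP).

HB.instance Definition _ :=
  Measure.copy riesz_measure (measure_extension (clopen_content LP)).

Lemma riesz_measure_clopen (A : set cantor_space) : clopen A ->
  riesz_measure A = (L \1_A)%:E.
Proof. by move=> cA; rewrite /riesz_measure /measure_extension measurable_mu_extE. Qed.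

Let riesz_setT : riesz_measure setT = 1%E.
Proof.
rewrite riesz_measure_clopen; last exact: clopenT.
by rewrite indicT (pmean_cst LP).
Qed.

HB.instance Definition _ :=
  Measure_isProbability.Build _ _ _ riesz_measure riesz_setT.

Theorem riesz_integral (g : cantor_space -> R) : continuous g ->
  \int[riesz_measure]_x g x = L g.
Proof.
move=> cg; apply/eqP; rewrite -subr_eq0 -normr_le0; apply/ler_addgt0Pl => e e0.
rewrite addr0.
have [|s cs gs] := @clopen_step_approx R g (e / 2) cg; first by rewrite divr_gt0.
have bg : bounded_fn g by apply: continuous_bounded_fn => //; exact: cantor_space_compact.
have mg := continuous_cantor_measurable cg.
have bs := clopen_step_bounded cs; have ms := clopen_step_measurable cs.
have sE : \int[riesz_measure]_x s x = L s.
  elim: cs {gs bs ms} => [|c A {}s cA cs ih].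
    by rewrite Rintegral_cst// mul0r (pmean_cst LP).
  have iA : riesz_measure.-integrable setT (EFin \o (\1_A : cantor_borel -> R)).
    apply: bounded_integrable_prob; last exact: bounded_indic.
    by apply: measurable_indic; exact: cantor_borel_clopen.
  rewrite RintegralD//; last 2 first.
  - by apply: bounded_integrable_prob; [exact: clopen_step_measurable|exact: clopen_step_bounded].
  - apply: bounded_integrable_prob; last by apply: bounded_fnZ; exact: bounded_indic.
    apply: measurable_funM; first exact: measurable_cst.
    by apply: measurable_indic; exact: cantor_borel_clopen.
  rewrite RintegralZl// ih (pmeanD LP)//; last 2 first.
  - exact: clopen_step_bounded.
  - by apply: bounded_fnZ; exact: bounded_indic.
  rewrite (pmeanZ LP _ (bounded_indic _)) /Rintegral integral_indic//.
    rewrite setIT; congr (_ + _ * _).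
    exact: (congr1 fine (riesz_measure_clopen cA)).
  exact: cantor_borel_clopen.
have h1 := Rintegral_dist riesz_measure mg bg ms bs gs.
have h2 := pmean_dist LP bg bs gs.
rewrite sE in h1.
have -> : \int[riesz_measure]_x g x - L g =
  (\int[riesz_measure]_x g x - L s) - (L g - L s) by lra.
by apply: le_trans (ler_normB _ _) _; lra.
Qed.

End riesz.

(** * Borel measures on products of row vectors *)

Section open_indicator.
Context {R : realType} {V : normedModType R}.

Definition set_dist (A : set V) (x : V) : R := inf [set `|x - a| | a in A].

Lemma set_dist_le A x a : A a -> set_dist A x <= `|x - a|.
Proof.
by move=> Aa; apply: ge_inf; [exists 0 => _ [b _ <-]|exists a].
Qed.

Lemma set_dist_lip A x y : A !=set0 -> set_dist A x - set_dist A y <= `|x - y|.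
Proof.
move=> [a0 Aa0]; rewrite lerBlDr addrC -lerBlDr; apply: lb_le_inf.
  by exists `|y - a0|, a0.
move=> _ [a Aa <-]; rewrite lerBlDl.
by apply: le_trans (set_dist_le x Aa) _; exact: ler_distD.
Qed.

Lemma set_dist_continuous A : A !=set0 -> continuous (set_dist A).
Proof.
move=> A0 x; apply/cvgrPdist_le => e e0; near=> y.
apply: (@le_trans _ _ `|x - y|).
  rewrite ler_norml set_dist_lip// andbT lerNl opprB distrC.
  exact: set_dist_lip.
near: y; apply: (@cvgr_dist_le _ _ _ (nbhs x) _ id x) => //; exact: cvg_id.
Unshelve. all: by end_near. Qed.

Lemma set_dist_gt0 A x : A !=set0 -> closed A -> ~ A x -> 0 < set_dist A x.
Proof.
move=> [a0 Aa0] cA nAx.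
have : nbhs x (~` A) by apply: open_nbhs_nbhs; split => //; exact: closed_openC.
move=> /nbhs_ballP[e /= e0 eA]; apply: (lt_le_trans e0); apply: lb_le_inf.
  by exists `|x - a0|, a0.
move=> _ [a Aa <-]; rewrite leNgt; apply/negP => xa.
by apply: (eA a) => //; rewrite -ball_normE.
Qed.

Lemma open_indic_approx (U : set V) : open U -> exists g : nat -> V -> R,
  [/\ forall n, continuous (g n), forall n x, 0 <= g n x <= 1 &
      forall x, g n x @[n --> \oo] --> (\1_U x : R)].
Proof.
move=> oU; have [UT|/setTPn[a Ua]] := eqVneq U setT.
  exists (fun _ => cst 1); split=> [n x|n x|x]; first exact: cvg_cst.
    by rewrite /= ler01 lexx.
  by rewrite UT indicT; exact: cvg_cst.
have nU0 : ~` U !=set0 by exists a.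
have cU : closed (~` U) by exact: open_closedC.
exists (fun n x => Num.min 1 (n%:R * set_dist (~` U) x)); split.
- move=> n x; apply: (@continuous_min _ _ (cst 1)
    (fun x => n%:R * set_dist (~` U) x) x); first exact: cvg_cst.
  by apply: cvgM; [exact: cvg_cst|exact: set_dist_continuous].
- move=> n x; rewrite ge_min lexx/= le_min ler01/= mulr_ge0//.
  by apply: lb_le_inf; [exists `|x - a|, a|move=> _ [b _ <-]].
move=> x; rewrite indicE; have [Ux|nUx] := boolP (x \in U); last first.
  rewrite (_ : (fun n => _) = cst 0); first exact: cvg_cst.
  apply/funext => n; suff -> : set_dist (~` U) x = 0 by rewrite mulr0 min_r.
  apply/eqP; rewrite eq_le; apply/andP; split.
    have /(set_dist_le x) : (~` U) x by move=> /mem_set; exact/negP.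
    by rewrite subrr normr0.
  by apply: lb_le_inf; [exists `|x - a|, a|move=> _ [b _ <-]].
have dx : 0 < set_dist (~` U) x.
  by apply: set_dist_gt0 => //; apply; exact: set_mem.
apply/cvgrPdist_le => e e0; near=> n.
rewrite min_l; first by rewrite subrr normr0 ltW.
by rewrite -ler_pdivrMr// div1r; near: n; exact: nbhs_infty_ger.
Unshelve. all: by end_near. Qed.

End open_indicator.

Section borel_rV_theory.
Context {R : realType}.

Lemma open_measurable_rV n (U : set 'rV[R]_n) : open U -> measurable U.
Proof. exact: sub_sigma_algebra. Qed.

Lemma compact_measurable_rV n (K : set 'rV[R]_n) : compact K -> measurable K.
Proof.
move=> cK; rewrite -(setCK K); apply: measurableC.
apply: open_measurable_rV; apply: closed_openC; exact: compact_closed.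
Qed.

Lemma continuous_measurable_rV n (g : 'rV[R]_n -> R) :
  continuous g -> measurable_fun setT g.
Proof.
move=> cg; apply: (measurability _ (RGenOInfty.measurableE R)).
move=> _ [_ [x ->] <-]; rewrite setTI; apply: open_measurable_rV.
move/continuousP: cg; apply; exact: interval_open.
Qed.

Lemma continuous_cantor_measurable_rV n (f : cantor_space -> 'rV[R]_n) :
  continuous f -> measurable_fun [set: cantor_borel] (f : cantor_borel -> 'rV[R]_n).
Proof.
move=> cf; apply: (measurability (@open 'rV[R]_n)) => //.
move=> _ [U oU <-]; rewrite setTI.
have [g [cg _ gU]] := open_indic_approx oU.
have mU : measurable_fun [set: cantor_borel] (\1_U \o f : cantor_borel -> R).
  apply: (@measurable_fun_cvg _ cantor_borel R setT (fun n => g n \o f)).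
    move=> m; apply: continuous_cantor_measurable => x.
    by apply: continuous_comp; [exact: cf|exact: cg].
  by move=> x _; exact: gU.
rewrite (_ : f @^-1` U = setT `&` (\1_U \o f) @^-1` [set 1 : R]).
  exact: mU.
rewrite setTI; apply/seteqP; split=> x /=; rewrite indicE.
  by move=> /mem_set ->.
by have [/set_mem//|_ /eqP] := boolP (f x \in U); rewrite eq_sym oner_eq0.
Qed.

Variables a b : nat.
Local Notation X := ('rV[R]_a).
Local Notation Y := ('rV[R]_b).

Lemma measurable_open_rectangles :
  @measurable _ (X * Y)%type = <<s [set U `*` V | U in @open X & V in @open Y] >>.
Proof.
set G := [set _ `*` _ | _ in _ & _ in _].
apply/seteqP; split; last first.
  apply: smallest_sub; first exact: sigma_algebra_measurable.
  by move=> _ [U oU [V oV <-]]; apply: measurableX; exact: open_measurable_rV.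
pose T := g_sigma_algebraType G.
have m1 : measurable_fun [set: T] (fst : T -> X).
  apply: (measurability (@open X)) => // _ [U oU <-]; rewrite setTI.
  apply: sub_sigma_algebra; exists U => //; exists setT; first exact: openT.
  by apply/seteqP; split=> -[x y] //= [].
have m2 : measurable_fun [set: T] (snd : T -> Y).
  apply: (measurability (@open Y)) => // _ [U oU <-]; rewrite setTI.
  apply: sub_sigma_algebra; exists setT; first exact: openT.
  by exists U => //; apply/seteqP; split=> -[x y] //= [].
have m12 := measurable_fun_pair m1 m2.
move=> A mA; have := m12 measurableT A mA; rewrite setTI.
by congr (_ _); apply/seteqP; split=> -[].
Qed.

Lemma measure_eq_continuous (P Q : {measure set (X * Y)%type -> \bar R}) :
  (P setT < +oo)%E -> (Q setT < +oo)%E ->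
  (forall (g : X -> R) (h : Y -> R), continuous g -> continuous h ->
     (forall x, 0 <= g x <= 1) -> (forall y, 0 <= h y <= 1) ->
     (\int[P]_z (g z.1 * h z.2)%:E = \int[Q]_z (g z.1 * h z.2)%:E)%E) ->
  forall A, measurable A -> P A = Q A.
Proof.
move=> Poo Qoo PQ; apply: (measure_unique _ (fun=> setT) measurable_open_rectangles).
- move=> _ _ [U oU [V oV <-]] [U' oU' [V' oV' <-]]; rewrite -setXI.
  by exists (U `&` U'); [exact: openI|exists (V `&` V'); [exact: openI|]].
- by move=> _; exists setT; [exact: openT|exists setT; [exact: openT|rewrite setXTT]].
- by rewrite bigcup_const.
- move=> _ [U oU [V oV <-]].
  have [g [cg g01 gU]] := open_indic_approx oU.
  have [h [ch h01 hV]] := open_indic_approx oV.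
  have lim (M : {measure set (X * Y)%type -> \bar R}) : (M setT < +oo)%E ->
      ((\int[M]_z (g n z.1 * h n z.2)%:E)%E @[n --> \oo] --> M (U `*` V)).
    move=> Moo; have -> : M (U `*` V) = (\int[M]_z (\1_U z.1 * \1_V z.2)%:E)%E.
      rewrite -(setIT (U `*` V)) -integral_indic//; last first.
        by apply: measurableX; exact: open_measurable_rV.
      apply: eq_integral => -[x y] _; congr EFin.
      by rewrite !indicE in_setX; case: (_ \in U); case: (_ \in V);
        rewrite /= ?mulr1 ?mulr0 ?mul0r.
    apply: (@dominated_cvg _ _ _ _ setT _ _ _ (cst 1%E)) => //.
    - move=> n; apply/measurable_EFinP; apply: measurable_funM.
        apply: measurableT_comp; last exact: measurable_fst.
        exact: continuous_measurable_rV.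
      apply: measurableT_comp; last exact: measurable_snd.
      exact: continuous_measurable_rV.
    - move=> [x y] _; apply: cvg_EFin; first exact: nearW.
      by apply: cvgM; [exact: gU|exact: hV].
    - apply: (@measurable_bounded_integrable _ _ _ _ (cst 1)) => //.
      by exists 1; split => // x x1 y _; rewrite /= normr1 ltW.
    - move=> n [x y] _; rewrite /= lee_fin normrM.
      have /andP[g0 g1] := g01 n x; have /andP[h0 h1] := h01 n y.
      by rewrite !ger0_norm// mulr_ile1.
  have limP := lim P Poo.
  rewrite (_ : (fun n => _) = fun n => \int[Q]_z (g n z.1 * h n z.2)%:E)%E in limP;
    last by apply/funext => n; exact: PQ.
  exact: (cvg_unique _ limP (lim Q Qoo)).
- by [].
Qed.

Lemma compact_measurable_prod (C : set (X * Y)) : compact C -> measurable C.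
Proof.
move=> cC.
pose T : ptopologicalType := HB.pack_for ptopologicalType (X * Y)%type
  (isPointed.Build (X * Y)%type (0, 0)).
have cov : cover_compact C.
  by have := compact_cover T => /(congr1 (fun f => f C)) <-.
pose B (n : nat) (z : X * Y) := ball z.1 n.+1%:R^-1 `*` ball z.2 n.+1%:R^-1.
have /choice[D DP] : forall n : nat, exists D : set (X * Y),
    [/\ finite_set D, D `<=` C & C `<=` \bigcup_(z in D) B n z].
  move=> n; have [z Cz|z Cz|D DC CD] := cov _ C (B n).
  - exact: (@ball_open _ (X * Y)%type z).
  - by exists z => //; split => /=; exact: ballxx.
  - exists [set` finmap.enum_fset D]; split => //; first exact: finite_seq.
    by move=> z zD; apply: set_mem; exact: DC.
have -> : C = \bigcap_n \bigcup_(z in D n) B n z.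
  apply/seteqP; split=> [z Cz n _|z Dz]; first by have [_ _] := DP n; apply.
  have hXY : hausdorff_space (X * Y)%type by exact: norm_hausdorff.
  apply: (compact_closed hXY cC) => W /nbhs_ballP[e /= e0 eW].
  have [n ne] : exists n : nat, n.+1%:R^-1 < e.
    have [n _ /(_ n (leqnn n)) h] := near_infty_natSinv_lt (PosNum e0).
    by exists n.
  have [w Dw [b1 b2]] := Dz n Logic.I.
  exists w; split; first by have [_ + _] := DP n; apply.
  apply: eW; split; apply: ball_sym; apply: (le_ball (ltW ne)) => //.
apply: bigcapT_measurable => n; apply: fin_bigcup_measurable.
  by have [] := DP n.
by move=> z _; apply: measurableX; apply: open_measurable_rV; exact: ball_open.
Qed.

Lemma within_continuous_measurable (K : set (X * Y)) (f : X * Y -> R) :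
  compact K -> {within K, continuous f} -> measurable_fun K f.
Proof.
move=> cK cf; apply: (measurability _ (RGenCInfty.measurableE R)).
move=> _ [_ [x ->] <-]; apply: compact_measurable_prod.
have /closed_subspaceP[V cV VK] : closed (f @^-1` `[x, +oo[ : set (subspace K)).
  by move/continuous_closedP : cf; apply; exact: interval_closed.
rewrite setIC -VK setIC; exact: compact_closedI.
Qed.

Lemma within_continuous_bounded (K : set (X * Y)) (f : X * Y -> R) :
  compact K -> {within K, continuous f} ->
  exists M : R, forall z, K z -> `|f z| <= M.
Proof.
move=> cK cf.
have /compact_bounded[M [_ /(_ (M + 1))]] : compact (f @` K).
  exact: continuous_compact.
rewrite ltrDl ltr01 => /(_ isT) h.
by exists (M + 1) => x Kx; apply: h; exists x.
Qed.

Lemma within_continuous_integrable (P : {measure set (X * Y)%type -> \bar R})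
    (K : set (X * Y)) (f : X * Y -> R) :
  (P K < +oo)%E -> compact K -> {within K, continuous f} -> P.-integrable K (EFin \o f).
Proof.
move=> PK cK cf; apply: measurable_bounded_integrable => //.
- exact: compact_measurable_prod.
- exact: within_continuous_measurable.
- have [M Mf] := within_continuous_bounded cK cf.
  exists M; split; first exact: num_real.
  by move=> x Mx y Ky; exact: le_trans (Mf y Ky) (ltW Mx).
Qed.

End borel_rV_theory.

Section measure_probability.
Context d (T : measurableType d) (R : realType).
Context (M : {measure set T -> \bar R}) (M1 : M setT = 1%E).

Let prob of M setT = 1%E : set T -> \bar R := M.

HB.instance Definition _ := Measure.copy (prob M1) M.
HB.instance Definition _ := Measure_isProbability.Build _ _ _ (prob M1) M1.

Lemma measure_probability : exists Q : probability T R, forall A, Q A = M A.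
Proof. by exists (prob M1 : probability T R). Qed.

End measure_probability.

Section marginal.
Context d1 d2 (T1 : measurableType d1) (T2 : measurableType d2) (R : realType).
Local Open Scope ereal_scope.

Lemma integral_marginal (theta : {measure set T1 -> \bar R})
    (rho : {measure set T2 -> \bar R}) (h : T1 -> T2) (D : set T2)
    (f : T2 -> \bar R) :
  measurable_fun setT h ->
  (forall A, measurable A -> theta (h @^-1` A) = rho A) ->
  measurable D -> rho.-integrable D f ->
  theta.-integrable (h @^-1` D) (f \o h) /\
  \int[rho]_(z in D) f z = \int[theta]_(p in h @^-1` D) f (h p).
Proof.
move=> mh theta_rho mD /integrableP[mf foo].
have mhD : measurable (h @^-1` D) by rewrite -[X in measurable X]setTI; exact: mh.
have ge0 g : measurable_fun D g -> (forall y, 0 <= g y) ->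
    \int[rho]_(z in D) g z = \int[theta]_(p in h @^-1` D) (g \o h) p.
  move=> mg g0; rewrite -(ge0_integral_pushforward mh)//.
  by apply: eq_measure_integral => A mA _; rewrite -theta_rho.
have mfh : measurable_fun (h @^-1` D) (f \o h).
  apply: (measurable_comp mD) => //; first by move=> _ [p Dp <-].
  exact: measurable_funTS.
have ifh : theta.-integrable (h @^-1` D) (f \o h).
  apply/integrableP; split => //; move: foo; rewrite ge0//.
  by apply: measurableT_comp => //.
split => //; rewrite [LHS]integralE [RHS]integralE.
rewrite (ge0 _ (measurable_funepos mf))// (ge0 _ (measurable_funeneg mf))//.
by congr (_ - _); apply: eq_integral => p _; rewrite /= !(funeposE, funenegE).
Qed.

Lemma integral_full_set (theta : probability T1 R) (K D : set T1)
    (f : T1 -> \bar R) :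
  measurable K -> measurable D -> K `<=` D -> theta K = 1 ->
  theta.-integrable D f ->
  \int[theta]_(p in D) f p = \int[theta]_(p in K) f p.
Proof.
move=> mK mD KD tK intf.
rewrite (@negligible_integral _ _ _ _ D (D `\` K))//; last 2 first.
- exact: measurableD.
- apply/eqP; rewrite eq_le measure_ge0 andbT.
  apply: (@le_trans _ _ (theta (~` K))).
    apply: le_measure; rewrite ?inE; [exact: measurableD|exact: measurableC|].
    by move=> x [].
  by rewrite probability_setC// tK subee.
by rewrite setDD setIidr.
Qed.

Lemma integral_marginal_full (theta : probability T1 R)
    (rho : {measure set T2 -> \bar R}) (h : T1 -> T2) (D : set T2) (K : set T1)
    (f : T2 -> R) :
  measurable_fun setT h ->
  (forall A, measurable A -> theta (h @^-1` A) = rho A) ->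
  measurable D -> measurable K -> K `<=` h @^-1` D -> theta K = 1 ->
  rho.-integrable D (EFin \o f) ->
  theta.-integrable K (EFin \o (f \o h)) /\
  (\int[rho]_(z in D) f z = \int[theta]_(p in K) f (h p))%R.
Proof.
move=> mh theta_rho mD mK KD tK intf.
have [ifh fE] := integral_marginal mh theta_rho mD intf.
have mhD : measurable (h @^-1` D) by rewrite -[X in measurable X]setTI; exact: mh.
split; first exact: (integrableS mhD).
by congr fine; rewrite [LHS]fE; exact: integral_full_set.
Qed.

Lemma pushforward_probability (P : probability T1 R) (f : T1 -> T2) :
  measurable_fun setT f ->
  exists Q : probability T2 R, forall A, Q A = P (f @^-1` A).
Proof.
move=> mf.
pose F : {mfun T1 >-> T2} := HB.pack_for {mfun T1 >-> T2} f
  (isMeasurableFun.Build _ _ _ _ f mf).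
by exists (distribution P F : probability T2 R).
Qed.

Lemma product_probability (P : probability T1 R) (Q : probability T2 R) :
  exists PQ : probability (T1 * T2)%type R, forall A, PQ A = (P \x Q) A.
Proof.
apply: measure_probability.
rewrite -setXTT [LHS]product_measure1E// -[RHS]mule1.
by congr (_ * _); exact: probability_setT.
Qed.

End marginal.

(** * Duality *)

Section duality.
Context (R : realType) (k d : nat) (K1 : set 'rV[R]_k) (K2 K3 : set 'rV[R]_d).
Context (cK1 : compact K1) (cK2 : compact K2) (cK3 : compact K3).
Context (nu : probability ('rV[R]_k * 'rV[R]_d)%type R).
Context (m : probability 'rV[R]_k R) (mu : probability 'rV[R]_d R).
Context (nu_supp : nu (K1 `*` K2) = 1%E) (mu_supp : mu K3 = 1%E).
Context (m_marg : forall A : set 'rV[R]_k, measurable A -> m A = nu (A `*` setT)).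

Local Notation X := 'rV[R]_k.
Local Notation Y := 'rV[R]_d.
Local Notation Z := (X * Y * Y)%type.
Local Notation pxy := (@proj_xy R k d).
Local Notation pxu := (@proj_xu R k d).
Local Notation K12 := (K1 `*` K2).
Local Notation K13 := (K1 `*` K3).
Local Notation K := (K1 `*` K2 `*` K3).

Definition is_coupling (theta : probability Z R) :=
  theta K = 1%E /\
  (forall A, measurable A -> theta (pxy @^-1` A) = nu A) /\
  (forall A, measurable A -> theta (pxu @^-1` A) = (m \x mu)%E A).

Definition inner_cost (p : Z) : R := dotv p.2 p.1.2.

Definition dual_value (psi phi : X * Y -> R) : R :=
  \int[nu]_(z in K12) psi z + \int[(m \x mu)%E]_(z in K13) phi z.

Lemma measurable_proj_xy : measurable_fun setT pxy.
Proof. exact: measurable_fst. Qed.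

Lemma measurable_proj_xu : measurable_fun setT pxu.
Proof.
apply: measurable_fun_pair; last exact: measurable_snd.
by apply: measurableT_comp => //; exact: measurable_fst.
Qed.

Lemma inner_cost_continuous : continuous inner_cost.
Proof.
move=> p; apply: cvg_big => [|i _]; first exact: add_continuous.
apply: cvgM.
  apply: (@continuous_comp _ _ _ (snd : Z -> Y) (fun v : Y => v 0 i)).
    exact: cvg_snd.
  exact: coord_continuous.
apply: (@continuous_comp _ _ _ (fun p : Z => p.1.2) (fun v : Y => v 0 i)).
  apply: (@continuous_comp _ _ _ (fst : Z -> X * Y) snd).
    exact: cvg_fst.
  exact: cvg_snd.
exact: coord_continuous.
Qed.

Lemma measurable_inner_cost : measurable_fun setT inner_cost.
Proof.
apply: measurable_sum => i; apply: measurable_funM.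
  apply: (measurableT_comp (continuous_measurable_rV (@coord_continuous _ _ _ 0 i))).
  exact: measurable_snd.
apply: (measurableT_comp (continuous_measurable_rV (@coord_continuous _ _ _ 0 i))).
apply: measurableT_comp; first exact: measurable_snd.
exact: measurable_fst.
Qed.

Let mK12 : measurable K12.
Proof. by apply: measurableX; exact: compact_measurable_rV. Qed.

Let mK13 : measurable K13.
Proof. by apply: measurableX; exact: compact_measurable_rV. Qed.

Let mK : measurable K.
Proof. by apply: measurableX => //; exact: compact_measurable_rV. Qed.

Let cK12 : compact K12. Proof. exact: compact_setX. Qed.
Let cK13 : compact K13. Proof. exact: compact_setX. Qed.
Let cK : compact K. Proof. exact: compact_setX. Qed.

Let mmu_lty A : measurable A -> ((m \x mu) A < +oo)%E.
Proof.
move=> mA; have [Q <-] := product_probability m mu.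
by rewrite -ge0_fin_numE// fin_num_measure.
Qed.

Let nu_lty A : measurable A -> (nu A < +oo)%E.
Proof. by move=> mA; rewrite -ge0_fin_numE// fin_num_measure. Qed.

Lemma inner_cost_integrable (theta : probability Z R) :
  theta.-integrable K (EFin \o inner_cost).
Proof.
apply: measurable_bounded_integrable => //.
- by rewrite -ge0_fin_numE// fin_num_measure.
- exact: measurable_funTS measurable_inner_cost.
have /compact_bounded[M [Mr Mc]] : compact (inner_cost @` K).
  by apply: continuous_compact => //; apply: continuous_subspaceT; exact: inner_cost_continuous.
by exists M; split => // x Mx p Kp; apply: Mc => //; exists p.
Qed.

Lemma weak_duality theta (psi phi : X * Y -> R) (c : Z -> R) : is_coupling theta ->
  nu.-integrable K12 (EFin \o psi) -> (m \x mu)%E.-integrable K13 (EFin \o phi) ->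
  theta.-integrable K (EFin \o c) ->
  (forall p, K p -> c p <= psi (pxy p) + phi (pxu p)) ->
  \int[theta]_(p in K) c p <= dual_value psi phi.
Proof.
move=> [tK [txy txu]] ipsi iphi ic cle; rewrite /dual_value.
have [|i1 ->] := integral_marginal_full measurable_proj_xy txy mK12 mK _ tK ipsi.
  by move=> p [].
have [|i2 ->] := integral_marginal_full measurable_proj_xu txu mK13 mK _ tK iphi.
  by move=> p [[? ?] ?].
rewrite -RintegralD//; apply: le_Rintegral => //.
rewrite (_ : EFin \o _ = (EFin \o (psi \o pxy)) \+ (EFin \o (phi \o pxu)))%E//.
exact: integrableD.
Qed.

Lemma product_coupling : exists theta, is_coupling theta.
Proof.
have [theta thetaE] := product_probability nu mu; exists theta.
split; last split.
- rewrite thetaE product_measure1E//; last exact: compact_measurable_rV.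
  by rewrite -[RHS]mule1; congr (_ * _)%E.
- move=> A mA; rewrite thetaE (_ : _ @^-1` A = A `*` setT).
    rewrite product_measure1E// -[RHS]mule1; congr (_ * _)%E.
    exact: probability_setT.
  by apply/seteqP; split=> -[z u] //= [].
have [Q QE] := pushforward_probability theta measurable_proj_xu.
move=> A mA; rewrite -QE; apply/esym; apply: product_measure_unique => // B C mB mC.
rewrite [LHS]QE thetaE (_ : _ @^-1` _ = (B `*` setT) `*` C).
  rewrite product_measure1E//; last exact: measurableX.
  by congr (_ * _)%E; apply/esym; exact: m_marg.
by apply/seteqP; split=> -[[x y] u] //= [] // [].
Qed.

Let wcnu (psi : X * Y -> R) : {within K12, continuous psi} -> nu.-integrable K12 (EFin \o psi).
Proof. by move=> cpsi; apply: within_continuous_integrable => //; exact: nu_lty. Qed.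

Let wcmmu (phi : X * Y -> R) : {within K13, continuous phi} ->
  (m \x mu)%E.-integrable K13 (EFin \o phi).
Proof. by move=> cphi; apply: within_continuous_integrable => //; exact: mmu_lty. Qed.

Lemma dual_valueD (psi phi psi' phi' : X * Y -> R) :
  {within K12, continuous psi} -> {within K13, continuous phi} ->
  {within K12, continuous psi'} -> {within K13, continuous phi'} ->
  dual_value (fun z => psi z + psi' z) (fun z => phi z + phi' z) =
  dual_value psi phi + dual_value psi' phi'.
Proof.
move=> c1 c2 c3 c4; rewrite /dual_value RintegralD ?wcnu// RintegralD ?wcmmu//.
by rewrite addrACA.
Qed.

Lemma dual_valueZ (t : R) (psi phi : X * Y -> R) :
  {within K12, continuous psi} -> {within K13, continuous phi} ->
  dual_value (fun z => t * psi z) (fun z => t * phi z) = t * dual_value psi phi.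
Proof.
by move=> c1 c2; rewrite /dual_value RintegralZl ?wcnu// RintegralZl ?wcmmu// mulrDr.
Qed.

Let wcD (T : topologicalType) (A : set T) (f g : T -> R) :
  {within A, continuous f} -> {within A, continuous g} ->
  {within A, continuous (fun z => f z + g z)}.
Proof. by move=> cf cg x; apply: cvgD; [exact: cf|exact: cg]. Qed.

Let wcZ (T : topologicalType) (A : set T) (t : R) (f : T -> R) :
  {within A, continuous f} -> {within A, continuous (fun z => t * f z)}.
Proof. by move=> cf x; apply: cvgM; [exact: cvg_cst|exact: cf]. Qed.

Let wcC (T : topologicalType) (A : set T) (c : R) :
  {within A, continuous (fun _ : T => c)}.
Proof. by move=> x; exact: cvg_cst. Qed.

Section pi.
Context (pi : cantor_space -> Z) (rpi : range pi = K).

Let Kpi w : K (pi w). Proof. by rewrite -rpi; exists w. Qed.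

Definition pull (psi phi : X * Y -> R) (w : cantor_space) : R :=
  psi (pxy (pi w)) + phi (pxu (pi w)).

Definition dominating (f : cantor_space -> R) : set ((X * Y -> R) * (X * Y -> R)) :=
  [set w | [/\ {within K12, continuous w.1}, {within K13, continuous w.2} &
    forall x, f x <= pull w.1 w.2 x]].

Definition dual_bound (f : cantor_space -> R) : R :=
  inf [set dual_value w.1 w.2 | w in dominating f].

Lemma dominating_ge f w (M : R) : dominating f w -> (forall x, M <= f x) ->
  M <= dual_value w.1 w.2.
Proof.
move=> [c1 c2 fw] Mf; have [theta cth] := product_coupling.
have tK : theta K = 1%E by case: cth.
have -> : M = \int[theta]_(p in K) cst M p.
  rewrite Rintegral_cst// [X in fine X](_ : _ = 1%E) ?mulr1//.
apply: weak_duality => //; [exact: wcnu|exact: wcmmu| |].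
  apply: measurable_bounded_integrable => //.
    by rewrite -ge0_fin_numE// fin_num_measure.
  by exists `|M|; split => // x Mx y _; exact: ltW.
rewrite -rpi => _ [x _ <-]; exact: le_trans (Mf x) (fw x).
Qed.

Lemma dual_bound_le f w : bounded_fn f -> dominating f w ->
  dual_bound f <= dual_value w.1 w.2.
Proof.
move=> [M Mf] fw; apply: ge_inf; last by exists w.
exists (- M) => _ [w' fw' <-]; apply: (dominating_ge fw') => x.
by have := Mf x; rewrite ler_norml => /andP[].
Qed.

Lemma le_dual_bound f (b : R) : bounded_fn f ->
  (forall w, dominating f w -> b <= dual_value w.1 w.2) -> b <= dual_bound f.
Proof.
move=> [M Mf] h; apply: lb_le_inf; last by move=> _ [w fw <-]; exact: h.
exists (dual_value (fun=> M) (fun=> 0)), (fun=> M, fun=> 0) => //.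
split => /= [||x]; [exact: wcC|exact: wcC|].
by rewrite /pull addr0; exact: le_trans (ler_norm _) (Mf x).
Qed.

Lemma dual_bound_sublinear :
  @sublinear_on R (cantor_space -> R^o) (@bounded_fn R cantor_space) dual_bound.
Proof.
split=> [f g bf bg|t f t0 bf].
  rewrite -lerBlDr; apply: le_dual_bound => // v [c1 c2 fv].
  rewrite lerBlDl -lerBlDr; apply: le_dual_bound => // w [c3 c4 gw].
  rewrite lerBlDr -dual_valueD//.
  apply: (@dual_bound_le _ (fun z => w.1 z + v.1 z, fun z => w.2 z + v.2 z)).
    exact: bounded_fnD.
  split => /=; [exact: wcD|exact: wcD|move=> x].
  by rewrite /pull addrACA addrC; exact: lerD (fv x) (gw x).
rewrite -ler_pdivrMl//; apply: le_dual_bound => // v [c1 c2 fv].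
rewrite ler_pdivrMl// -dual_valueZ//.
apply: (@dual_bound_le _ (fun z => t * v.1 z, fun z => t * v.2 z)).
  exact: bounded_fnZ.
split => /=; [exact: wcZ|exact: wcZ|move=> x].
by rewrite /pull -mulrDr; apply: ler_wpM2l (fv x); exact: ltW.
Qed.

Lemma bounded_pull (psi phi : X * Y -> R) : {within K12, continuous psi} ->
  {within K13, continuous phi} -> bounded_fn (pull psi phi).
Proof.
move=> c1 c2; have [M Mp] := within_continuous_bounded cK12 c1.
have [N Np] := within_continuous_bounded cK13 c2.
exists (M + N) => w; apply: le_trans (ler_normD _ _) _.
by have [[? ?] ?] := Kpi w; apply: lerD; [exact: Mp|exact: Np].
Qed.

Lemma exists_optimal_mean (f : cantor_space -> R) : bounded_fn f ->
  exists L, [/\ positive_mean L, L f = dual_bound f &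
    forall psi phi : X * Y -> R, {within K12, continuous psi} ->
      {within K13, continuous phi} -> L (pull psi phi) = dual_value psi phi].
Proof.
move=> bf.
have [|||L [LD LZ Lle Lf]] := @hahn_banach_on R (cantor_space -> R^o)
  (@bounded_fn R cantor_space) _ _ _ dual_bound f dual_bound_sublinear bf.
- exact: bounded_fnD.
- exact: bounded_fnZ.
- exact: bounded_cst.
have Lpull (psi phi : X * Y -> R) : {within K12, continuous psi} ->
    {within K13, continuous phi} -> L (pull psi phi) = dual_value psi phi.
  have half (psi' phi' : X * Y -> R) : {within K12, continuous psi'} ->
      {within K13, continuous phi'} -> L (pull psi' phi') <= dual_value psi' phi'.
    move=> c1 c2; have bp := bounded_pull c1 c2.
    apply: le_trans (Lle _ bp) _.
    by apply: (@dual_bound_le _ (psi', phi') bp); split.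
  move=> c1 c2; apply/eqP; rewrite eq_le half//=.
  have bp := bounded_pull c1 c2.
  have := half _ _ (@wcZ _ _ (-1) _ c1) (@wcZ _ _ (-1) _ c2).
  rewrite dual_valueZ// (_ : pull _ _ = -1 *: (pull psi phi : cantor_space -> R^o)).
    by rewrite (LZ _ _ bp) !mulN1r lerN2.
  by apply/funext => w; rewrite /pull -mulrDr.
exists L; split => //; split => [f' g' bf' bg'|t f' bf'|f' bf' f0|].
- exact: LD.
- exact: LZ.
- rewrite -oppr_le0 -mulN1r -(LZ (-1) _ bf').
  have bN : bounded_fn (-1 *: (f' : cantor_space -> R^o)) by exact: bounded_fnZ.
  apply: le_trans (Lle _ bN) _.
  have := @dual_bound_le _ (fun=> 0, fun=> 0) bN; rewrite /= => h.
  apply: le_trans (h _) _; last first.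
    by rewrite /dual_value !Rintegral_cst// !mul0r addr0.
  split => /= [||x]; [exact: wcC|exact: wcC|].
  by rewrite /pull addr0 -[_ x]/(-1 * f' x) mulN1r oppr_le0.
- have := Lpull (fun=> 1) (fun=> 0) (@wcC _ _ _) (@wcC _ _ _).
  rewrite /dual_value !Rintegral_cst// mul0r addr0 [X in fine X](_ : _ = 1%E)// mulr1 => h.
  by apply: (etrans _ h); congr L; apply/funext => w; rewrite /pull addr0.
Qed.

End pi.

Let EFin_Rintegral d' (T : measurableType d') (M : {measure set T -> \bar R})
    (D : set T) (f : T -> R) : measurable D -> M.-integrable D (EFin \o f) ->
  (\int[M]_(z in D) (f z)%:E)%E = (\int[M]_(z in D) f z)%:E.
Proof. by move=> mD intf; rewrite /Rintegral fineK//; exact: integrable_fin_num. Qed.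

Let m_supp : m K1 = 1%E.
Proof.
have mK1 : measurable K1 by exact: compact_measurable_rV.
apply/eqP; rewrite eq_le; apply/andP; split; first exact: probability_le1.
rewrite m_marg// -nu_supp; apply: le_measure; rewrite ?inE//.
  exact: measurableX.
by move=> z [].
Qed.

Let proj_xy_continuous : continuous pxy.
Proof. by move=> p; exact: cvg_fst. Qed.

Let proj_xu_continuous : continuous pxu.
Proof.
move=> p.
have c1 : {for p, continuous (fun q : Z => q.1.1)}.
  by apply: (@continuous_comp _ _ _ (fst : Z -> X * Y) fst); exact: cvg_fst.
have c2 : {for p, continuous (snd : Z -> Y)} by exact: cvg_snd.
exact: (cvg_pair c1 c2).
Qed.

Lemma optimal_coupling : exists2 theta, is_coupling theta &
  forall e, 0 < e -> exists psi phi : X * Y -> R,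
    [/\ {within K12, continuous psi}, {within K13, continuous phi},
        forall x y u, K1 x -> K2 y -> K3 u -> dotv u y <= psi (x, y) + phi (x, u) &
        dual_value psi phi < \int[theta]_(p in K) inner_cost p + e].
Proof.
have K0 : K !=set0.
  apply/set0P/eqP => K0; have [theta [tK _]] := product_coupling.
  by move: tK; rewrite K0 measure0 => /eqP; rewrite eq_sym onee_eq0.
have [pi cpi rpi] := @compact_cantor_surj R Z K (@norm_hausdorff _ _) cK K0.
have Kpi w : K (pi w) by rewrite -rpi; exists w.
have cf : continuous (inner_cost \o pi).
  by move=> w; apply: continuous_comp; [exact: cpi|exact: inner_cost_continuous].
have bf := continuous_bounded_fn cantor_space_compact cf.
have [L [LP Lf Lpull]] := exists_optimal_mean rpi bf.
pose P : probability cantor_borel R := riesz_measure LP.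
have mpi : measurable_fun [set: cantor_borel] (pi : cantor_borel -> Z).
  have -> : pi = (fun w => (((pi w).1.1, (pi w).1.2), (pi w).2)).
    by apply/funext => w; case: (pi w) => -[].
  apply: measurable_fun_pair; first apply: measurable_fun_pair.
  - apply: continuous_cantor_measurable_rV => w.
    apply: (@continuous_comp _ _ _ (fst \o pi) fst); last exact: cvg_fst.
    by apply: continuous_comp; [exact: cpi|exact: cvg_fst].
  - apply: continuous_cantor_measurable_rV => w.
    apply: (@continuous_comp _ _ _ (fst \o pi) snd); last exact: cvg_snd.
    by apply: continuous_comp; [exact: cpi|exact: cvg_fst].
  - apply: continuous_cantor_measurable_rV => w.
    by apply: continuous_comp; [exact: cpi|exact: cvg_snd].
have [theta thetaE] := pushforward_probability P mpi.
have PT : P setT = 1%E by exact: probability_setT.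
have thetaK : theta K = 1%E.
  by rewrite thetaE (_ : _ @^-1` _ = setT)// -subTset => w _; exact: Kpi.
have marg (q : Z -> X * Y) (rho : probability (X * Y)%type R) :
    measurable_fun setT q -> continuous q ->
    (forall psi : X * Y -> R, continuous psi -> measurable_fun setT psi ->
      bounded_fn psi -> L (psi \o q \o pi) = \int[rho]_z psi z) ->
    forall A, measurable A -> theta (q @^-1` A) = rho A.
  move=> mq cq Lq; have [Q QE] := pushforward_probability theta mq.
  move=> A mA; rewrite -QE; apply: measure_eq_continuous A mA.
  - by rewrite -ge0_fin_numE// fin_num_measure.
  - by rewrite -ge0_fin_numE// fin_num_measure.
  move=> g h cg ch g01 h01.
  pose psi (z : X * Y) := g z.1 * h z.2.
  have cpsi : continuous psi.
    move=> z; apply: cvgM.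
      by apply: continuous_comp; [exact: cvg_fst|exact: cg].
    by apply: continuous_comp; [exact: cvg_snd|exact: ch].
  have mpsi : measurable_fun setT psi.
    apply: measurable_funM.
      apply: measurableT_comp; last exact: measurable_fst.
      exact: continuous_measurable_rV.
    apply: measurableT_comp; last exact: measurable_snd.
    exact: continuous_measurable_rV.
  have bpsi : bounded_fn psi.
    exists 1 => z; rewrite /psi normrM.
    have /andP[g0 g1] := g01 z.1; have /andP[h0 h1] := h01 z.2.
    by rewrite !ger0_norm// mulr_ile1.
  have iQ := bounded_integrable_prob Q mpsi bpsi.
  rewrite (EFin_Rintegral measurableT iQ).
  rewrite (EFin_Rintegral measurableT (bounded_integrable_prob rho mpsi bpsi)).
  rewrite -Lq// -(riesz_integral LP).
    congr EFin; apply: (proj2 (@integral_marginal_full _ _ _ _ _ P Q (q \o pi)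
      setT setT psi _ _ _ _ _ _ _)) => //.
    - exact: measurableT_comp.
    - move=> B mB; apply/esym; apply: etrans (QE B) _; exact: thetaE.
  move=> w; apply: (@continuous_comp _ _ _ (q \o pi) psi); last exact: cpsi.
  by apply: continuous_comp; [exact: cpi|exact: cq].
exists theta.
  split => //; split.
    apply: marg; [exact: measurable_proj_xy|exact: proj_xy_continuous|].
    move=> psi cpsi mpsi bpsi.
    have c1 : {within K12, continuous psi} by exact: continuous_subspaceT.
    have := Lpull psi (fun=> 0) c1 (@wcC _ _ _).
    rewrite /dual_value Rintegral_cst// mul0r addr0 => LE.
    transitivity (\int[nu]_(z in K12) psi z).
      rewrite -LE; congr L; apply/funext => w; rewrite /pull/= addr0//.
    congr fine; apply/esym; apply: integral_full_set => //.
    exact: bounded_integrable_prob.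
  have [rho rhoE] := product_probability m mu.
  move=> A mA; rewrite -rhoE; apply: marg A mA;
    [exact: measurable_proj_xu|exact: proj_xu_continuous|].
  move=> phi cphi mphi bphi.
  have c2 : {within K13, continuous phi} by exact: continuous_subspaceT.
  have := Lpull (fun=> 0) phi (@wcC _ _ _) c2.
  rewrite /dual_value Rintegral_cst// mul0r add0r => LE.
  transitivity (\int[rho]_(z in K13) phi z).
    transitivity (\int[(m \x mu)%E]_(z in K13) phi z).
      rewrite -LE; congr L; apply/funext => w; rewrite /pull/= add0r//.
    by congr fine; apply: eq_measure_integral => B mB _; apply/esym; exact: rhoE.
  congr fine; apply/esym; apply: integral_full_set => //.
    rewrite rhoE product_measure1E//; try exact: compact_measurable_rV.
    rewrite -[RHS]mule1; congr (_ * _)%E => //; exact: m_supp.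
  exact: bounded_integrable_prob.
have costE : \int[theta]_(p in K) inner_cost p = dual_bound pi (inner_cost \o pi).
  rewrite -Lf -(riesz_integral LP)//.
  apply: (proj2 (@integral_marginal_full _ _ _ _ _ P theta pi K setT inner_cost
    _ _ _ _ _ _ _)) => //.
  - by move=> B mB; apply/esym; exact: thetaE.
  - by move=> w _; exact: Kpi.
  - exact: inner_cost_integrable.
move=> e e0; rewrite costE.
have [|_ [w [c1 c2 fw] <-] we] := @inf_adherent R
    [set dual_value w.1 w.2 | w in dominating pi (inner_cost \o pi)] e e0.
  split; last first.
    have [M Mf] := bf; exists (- M) => _ [w fw <-].
    apply: (dominating_ge rpi fw) => x.
    by have := Mf x; rewrite ler_norml => /andP[].
  have [M Mf] := bf; exists (dual_value (fun=> M) (fun=> 0)), (fun=> M, fun=> 0) => //.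
  split => /= [||x]; [exact: wcC|exact: wcC|].
  by rewrite /pull addr0; exact: le_trans (ler_norm _) (Mf x).
exists w.1, w.2; split => // x y u K1x K2y K3u.
have : K ((x, y), u) by [].
by rewrite -rpi => -[v _ vE]; have := fw v; rewrite /= /pull vE.
Qed.

Lemma EFin_inner_cost (theta : probability Z R) :
  (\int[theta]_(p in K) (dotv p.2 p.1.2)%:E)%E =
  (\int[theta]_(p in K) inner_cost p)%:E.
Proof. by rewrite -EFin_Rintegral//; exact: inner_cost_integrable. Qed.

Lemma EFin_dual_value (psi phi : X * Y -> R) :
  nu.-integrable K12 (EFin \o psi) -> (m \x mu)%E.-integrable K13 (EFin \o phi) ->
  (\int[nu]_(z in K12) (psi z)%:E + \int[m \x mu]_(z in K13) (phi z)%:E)%E =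
  (dual_value psi phi)%:E.
Proof. by move=> i1 i2; rewrite EFinD !EFin_Rintegral. Qed.

Lemma continuous_dual_integrable (psi phi : X * Y -> R) :
  {within K12, continuous psi} -> {within K13, continuous phi} ->
  nu.-integrable K12 (EFin \o psi) /\ (m \x mu)%E.-integrable K13 (EFin \o phi).
Proof. by move=> c1 c2; split; [exact: wcnu|exact: wcmmu]. Qed.

End duality.

Local Open Scope ereal_scope.

Theorem theoremC1 (R : realType) (k d : nat)
  (K1 : set 'rV[R]_k) (K2 K3 : set 'rV[R]_d)
  (cK1 : compact K1) (cK2 : compact K2) (cK3 : compact K3)
  (nu : probability ('rV[R]_k * 'rV[R]_d)%type R)
  (nu_supp : nu (K1 `*` K2) = 1)
  (m : probability 'rV[R]_k R)
  (m_marg : forall A : set 'rV[R]_k, measurable A -> m A = nu (A `*` setT))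
  (m_centered : forall i : 'I_k, \int[m]_x (x 0 i)%:E = 0)
  (mu : probability 'rV[R]_d R)
  (mu_supp : mu K3 = 1) :
  let I := [set theta : probability (('rV[R]_k * 'rV[R]_d) * 'rV[R]_d)%type R |
              theta ((K1 `*` K2) `*` K3) = 1 /\
              (forall A : set ('rV[R]_k * 'rV[R]_d)%type, measurable A -> theta (@proj_xy R k d @^-1` A) = nu A) /\
              (forall A : set ('rV[R]_k * 'rV[R]_d)%type, measurable A -> theta (@proj_xu R k d @^-1` A) = (m \x mu) A)] in
  let cost (theta : probability (('rV[R]_k * 'rV[R]_d) * 'rV[R]_d)%type R) :=
    \int[theta]_(p in (K1 `*` K2) `*` K3) (dotv p.2 p.1.2)%:E in
  let dual_obj (psi : 'rV[R]_k * 'rV[R]_d -> R) (phi : 'rV[R]_k * 'rV[R]_d -> R) :=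
    \int[nu]_(z in K1 `*` K2) (psi z)%:E +
    \int[m \x mu]_(z in K1 `*` K3) (phi z)%:E in
  let admissible (psi : 'rV[R]_k * 'rV[R]_d -> R) (phi : 'rV[R]_k * 'rV[R]_d -> R) :=
    forall x y u, K1 x -> K2 y -> K3 u -> (psi (x, y) + phi (x, u) >= dotv u y)%R in
  (exists2 theta0, I theta0 & cost theta0 = ereal_sup [set cost theta | theta in I]) /\
  ereal_sup [set cost theta | theta in I] =
    ereal_inf [set r | exists psi phi,
      [/\ {within K1 `*` K2, continuous psi}, {within K1 `*` K3, continuous phi},
           admissible psi phi & r = dual_obj psi phi]] /\
  ereal_sup [set cost theta | theta in I] =
    ereal_inf [set r | exists psi phi,
      [/\ nu.-integrable (K1 `*` K2) (EFin \o psi),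
           (m \x mu).-integrable (K1 `*` K3) (EFin \o phi),
           admissible psi phi & r = dual_obj psi phi]].
Proof.
move=> I cost dual_obj admissible.
have [theta0 cth0 opt] := optimal_coupling cK1 cK2 cK3 nu_supp mu_supp m_marg.
set S := ereal_sup _; set D := ereal_inf _; set D1 := ereal_inf _.
have SD1 : S <= D1.
  apply: ge_ereal_sup => _ [theta cth <-].
  apply: le_ereal_inf_tmp => _ [psi [phi [i1 i2 adm ->]]].
  rewrite /cost EFin_inner_cost// /dual_obj EFin_dual_value// lee_fin.
  apply: weak_duality => //; first exact: inner_cost_integrable.
  by move=> [[x y] u] [[? ?] ?]; exact: adm.
have D1D : D1 <= D.
  apply: ereal_inf_le_tmp => _ [psi [phi [c1 c2 adm ->]]].
  have [i1 i2] := continuous_dual_integrable cK1 cK2 cK3 nu m mu c1 c2.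
  by exists psi, phi; split.
have Dcost : D <= cost theta0.
  rewrite /cost EFin_inner_cost//; apply/lee_addgt0Pr => e e0.
  have [psi [phi [c1 c2 adm lt]]] := opt e e0.
  have [i1 i2] := continuous_dual_integrable cK1 cK2 cK3 nu m mu c1 c2.
  apply: (@le_trans _ _ (dual_obj psi phi)).
    by apply: ereal_inf_lbound; exists psi, phi; split.
  by rewrite /dual_obj EFin_dual_value// -EFinD lee_fin ltW.
have costS : cost theta0 <= S by apply: ereal_sup_ubound; exists theta0.
have SD : S = D.
  by apply/eqP; rewrite eq_le (le_trans SD1 D1D) (le_trans Dcost costS).
have SD1' : S = D1 by apply/eqP; rewrite eq_le SD1 SD D1D.
by split; [exists theta0 => //; apply/eqP; rewrite eq_le costS {1}SD Dcost|].
Qed.
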